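(* Let $2\le m\le n$ and $d=\gcd(m-1,n-1)$. The set of words $$W(m,n)=\{s,s^2,\dots,s^{m-1}\}\cup\{t,t^2,\dots,t^{n-1}\}\cup\bigcup_{j=1}^{d}\{s^jt,\ s^jts,\ t^js,\ t^jst\}\subseteq\{s,t\}^+$$ is comprised of exactly one representative from each equivalence class in $\mathbf{Ch}(m,n)$. Moreover, each such representative is in reduced form.
   Context: $\{s,t\}^+$ is the set of all nonempty finite words over $\{s,t\}$. For integers $2\le m\le n$, $\mathbf{Ch}(m,n)$ is the quotient $\{s,t\}^+/\equiv_{m,n}$, where $w_1\equiv_{m,n}w_2$ if and only if $w_1$ and $w_2$ act identically (as compositions of operators) on every poset $(L,\le)$ for all order-preserving maps $s,t:L\to L$ satisfying $s\le t$ (pointwise), $s^m=s$ and $t^n=t$. A word is in reduced form if no strictly shorter word lies in its equivalence class. *)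

(* Defs.v *)
From mathcomp Require Import all_boot all_order.
From mathcomp Require Import classical_sets.

Set Implicit Arguments.
Unset Strict Implicit.
Unset Printing Implicit Defensive.

Local Open Scope classical_set_scope.

Inductive letter := Ls | Lt.

Definition word := seq letter.

(* {s,t}^+ *)
Definition nonempty_words : set word := [set w | w <> [::]].

(* The leftmost letter is applied last: the word st acts as x |-> s (t x). *)
Fixpoint act (L : Type) (s t : L -> L) (w : word) (x : L) : L :=
  match w with
  | [::] => x
  | Ls :: w' => s (act s t w' x)
  | Lt :: w' => t (act s t w' x)
  end.

(* Classically every poset carries a porderType structure, so L ranges over
   all posets. *)
Definition word_equiv (m n : nat) (w1 w2 : word) : Prop :=
  forall (disp : Order.disp_t) (L : porderType disp) (s t : L -> L),
    {homo s : x y / (x <= y)%O} ->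
    {homo t : x y / (x <= y)%O} ->
    (forall x, (s x <= t x)%O) ->
    iter m s =1 s ->
    iter n t =1 t ->
    act s t w1 =1 act s t w2.

Definition word_class (m n : nat) (w : word) : set word :=
  [set v | nonempty_words v /\ word_equiv m n w v].

Definition Ch (m n : nat) : set (set word) :=
  word_class m n @` nonempty_words.

Definition reduced (m n : nat) (w : word) : Prop :=
  forall v, word_class m n w v -> ~~ (size v < size w).

Definition W (m n : nat) : set word :=
  let d := gcdn (m - 1) (n - 1) in
  [set nseq j Ls | j in [set j | 1 <= j <= m - 1]] `|`
  [set nseq j Lt | j in [set j | 1 <= j <= n - 1]] `|`
  \bigcup_(j in [set j | 1 <= j <= d])
    [set w | [\/ w = nseq j Ls ++ [:: Lt],
                 w = nseq j Ls ++ [:: Lt; Ls],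
                 w = nseq j Lt ++ [:: Ls] |
                 w = nseq j Lt ++ [:: Ls; Lt]]].

(* Main.v *)
(* With [d = gcd (m - 1, n - 1)], comparing [s^(1 + k (m - 1)) t] with
   [s t^(1 + k (m - 1))] gives [s t <= s t^(1 + d)] by Bezout, so [s t^j] is
   nondecreasing along steps of [d]; being periodic it has period [d].  Dually
   [s^j t] has period [d].  Trading [d - 1] letters [s] for [t] then yields
   [s^a t^(b + 1) <= s^(a + 1) t^b], the converse being clear, so
   [s t^j = s^j t].  A word [s u t] lies between [s s^|u| t] and [s t^|u| t],
   hence equals [s^(|u| + 1) t].  Reversing the order exchanges [s] and [t].
   Thus the class of a word with both letters depends only on its first letter,
   its last letter and its length modulo [d]; small posets show that these are
   invariants, as is the length of a power modulo [m - 1] or [n - 1]. *)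

Require Import Defs.
From HB Require Import structures.
From mathcomp Require Import all_boot all_order.
From mathcomp Require Import boolp classical_sets.
From mathcomp Require Import zify.
Import Order.POrderTheory.

Set Implicit Arguments.
Unset Strict Implicit.
Unset Printing Implicit Defensive.

Local Open Scope classical_set_scope.

(** * Letters and words *)

Definition is_t (a : letter) : bool := if a is Lt then true else false.

Definition letter_of_bool (b : bool) : letter := if b then Lt else Ls.

Lemma is_tK : cancel is_t letter_of_bool.
Proof. by case. Qed.

HB.instance Definition _ := Equality.copy letter (can_type is_tK).

Definition flip (a : letter) : letter := if a is Ls then Lt else Ls.

Lemma flipK : involutive flip.
Proof. by case. Qed.

Lemma flip_neq (a b : letter) : a != b -> b = flip a.
Proof. by case: a; case: b. Qed.

Definition exponent (m n : nat) (a : letter) : nat := if a is Ls then m else n.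

Definition pure (a : letter) (w : word) : bool := all (pred1 a) w.

Lemma impure_split (a : letter) (w : word) :
  ~~ pure a w -> exists i v, w = nseq i a ++ flip a :: v.
Proof.
elim: w => //= b w IHw; rewrite negb_and.
have [->|ba _] := eqVneq b a.
  by move=> /= /IHw[i [v ->]]; exists i.+1, v.
by exists 0, w; rewrite /= (@flip_neq a b) // eq_sym.
Qed.

Section Action.
Variables (L : Type) (s t : L -> L).

Lemma act_cat (w v : word) x : act s t (w ++ v) x = act s t w (act s t v x).
Proof. by elim: w => [|[] w IHw] //=; rewrite IHw. Qed.

Lemma act_nseq i (a : letter) x :
  act s t (nseq i a) x = iter i (if a is Ls then s else t) x.
Proof. by elim: i => //= i ->; case: a. Qed.

Lemma act_map_flip (w : word) : act s t (map flip w) =1 act t s w.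
Proof. by move=> x; elim: w => [|[] w IHw] //=; rewrite IHw. Qed.

End Action.

(** * Order-preserving operators *)

Lemma iter_period (T : Type) (f : T -> T) m i k :
  0 < m -> iter m f =1 f -> 0 < i ->
  iter (i + k * (m - 1)) f =1 iter i f.
Proof.
case: m i => // m [] // i _ fm _ x; rewrite subSS subn0.
have E j : iter (j.+1 + m) f =1 iter j.+1 f.
  by move=> y; rewrite addSnnS iterD fm -iterSr.
elim: k => [|k IHk]; first by rewrite addn0.
by rewrite mulSn addnCA addnC addSn E -addSn.
Qed.

(** Climbing in steps of [d] from [g (i + d)] reaches [g (i + p)], which is [g i] again, so the
    inequalities on the way collapse. *)
Lemma nondecreasing_periodic (disp : Order.disp_t) (L : porderType disp)
    (g : nat -> L) d p i :
  0 < p -> d %| p -> (forall i, g i <= g (i + d))%O ->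
  (forall i, g (i + p) = g i) -> g (i + d) = g i.
Proof.
move=> p_gt0 /dvdnP[k pE] g_le gp.
have le_gk j l : (g j <= g (j + l * d))%O.
  elim: l => [|l IHl]; first by rewrite addn0.
  by rewrite mulSnr addnA; apply: le_trans IHl (g_le _).
apply/le_anti/andP; split=> //.
have := le_gk (i + d) k.-1; rewrite -addnA -mulSn prednK -?pE ?gp //.
by case: k pE p_gt0 => // ->.
Qed.

Section OrderPreservingPair.
Variables (disp : Order.disp_t) (L : porderType disp) (s t : L -> L).
Variables (m n : nat).
Hypotheses (m_gt1 : 1 < m) (n_gt1 : 1 < n).
Hypotheses (s_mono : {homo s : x y / (x <= y)%O}).
Hypotheses (t_mono : {homo t : x y / (x <= y)%O}).
Hypothesis s_le_t : forall x, (s x <= t x)%O.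
Hypotheses (sm : iter m s =1 s) (tn : iter n t =1 t).

Let d := gcdn (m - 1) (n - 1).
Let m_gt0 : 0 < m := ltnW m_gt1.
Let n_gt0 : 0 < n := ltnW n_gt1.

Lemma iter_mono (f : L -> L) i :
  {homo f : x y / (x <= y)%O} -> {homo iter i f : x y / (x <= y)%O}.
Proof. by move=> f_mono x y xy; elim: i => //= i; apply: f_mono. Qed.

Lemma iter_s_le_act (w : word) x : (iter (size w) s x <= act s t w x)%O.
Proof.
elim: w => [|[] w IHw] //=; first exact: s_mono.
exact: le_trans (s_le_t _) (t_mono IHw).
Qed.

Lemma act_le_iter_t (w : word) x : (act s t w x <= iter (size w) t x)%O.
Proof.
elim: w => [|[] w IHw] //=; last exact: t_mono.
exact: le_trans (s_mono IHw) (s_le_t _).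
Qed.

Lemma iter_s_le_iter_t i x : (iter i s x <= iter i t x)%O.
Proof. by have := iter_s_le_act (nseq i Lt) x; rewrite size_nseq act_nseq. Qed.

(* Bezout: [k (m - 1) = d + l (n - 1)] for some [k] and [l], so
   [s t = s^(1 + k (m - 1)) t <= s t^(1 + d + l (n - 1)) = s t^(1 + d)]. *)
Lemma st_le_period x : (s (t x) <= s (iter d.+1 t x))%O.
Proof.
have m1_gt0 : 0 < m - 1 by rewrite subn_gt0.
have [l _ /dvdnP[k Ek]] := Bezoutl (n - 1) m1_gt0; rewrite -/d in Ek.
rewrite -[s (t x)](iter_period k m_gt0 sm (isT : 0 < 1)).
rewrite -(iter_period l n_gt0 tn (ltn0Sn d)).
rewrite (addSn d) Ek add1n iterS; apply: s_mono.
by rewrite iterSr; apply: iter_s_le_iter_t.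
Qed.

(** Bezout with the roles exchanged, k (n - 1) = d + l (m - 1), gives s^(1 + d) t = s^(1 + k (n -
    1)) t <= s t^(1 + k (n - 1)) = s t. *)
Lemma st_ge_period x : (iter d.+1 s (t x) <= s (t x))%O.
Proof.
have n1_gt0 : 0 < n - 1 by rewrite subn_gt0.
have [l _ /dvdnP[k Ek]] := Bezoutr (m - 1) n1_gt0; rewrite -/d in Ek.
rewrite -(iter_period l m_gt0 sm (ltn0Sn d)) (addSn d) Ek iterS.
apply: s_mono; rewrite -[X in (_ <= X)%O](iter_period k n_gt0 tn (isT : 0 < 1)).
by rewrite add1n iterSr; apply: iter_s_le_iter_t.
Qed.

Lemma st_periodr b x : 0 < b -> s (iter (b + d) t x) = s (iter b t x).
Proof.
case: b => // b _; apply: (@nondecreasing_periodic _ L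
    (fun i => s (iter i.+1 t x)) d (n - 1)).
- by rewrite subn_gt0.
- exact: dvdn_gcdr.
- by move=> i; rewrite -addSn addnC -addSnnS iterD; apply: st_le_period.
- by move=> i; rewrite -addSn -[n - 1]mul1n iter_period.
Qed.

(** Here [d] more letters s lower the value, so the periodicity argument is run in the dual
    order. *)
Lemma st_periodl a x : 0 < a -> iter (a + d) s (t x) = iter a s (t x).
Proof.
case: a => // a _; apply: (@nondecreasing_periodic _ L^d
    (fun i => iter i.+1 s (t x)) d (m - 1)).
- by rewrite subn_gt0.
- exact: dvdn_gcdl.
- move=> i; rewrite leEdual -addnS iterD [iter i.+1 s _]iterSr.
  exact/iter_mono/st_ge_period.
- by move=> i; rewrite -addSn -[m - 1]mul1n iter_period.
Qed.

Lemma st_shift a b x : 0 < a -> 0 < b ->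
  iter a s (iter b.+1 t x) = iter a.+1 s (iter b t x).
Proof.
move=> a_gt0 b_gt0; apply/le_anti/andP; split; last first.
  by rewrite iterSr; apply: iter_mono.
(* The chain is s^a t^(b+1) = s^(a+1) s^(d-1) t^(b+1) <= s^(a+1) t^(d-1) t^(b+1) = s^(a+1) t^b; both
   equalities use the period [d]. *)
rewrite [iter b.+1 t x]iterS -st_periodl //.
have d_gt0 : 0 < d by rewrite gcdn_gt0 subn_gt0 m_gt1.
have -> : a + d = a.+1 + (d - 1) by lia.
rewrite iterD [X in (_ <= X)%O]iterSr -st_periodr // -iterSr.
apply: iter_mono => //; have -> : b + d = d - 1 + b.+1 by lia.
by rewrite iterD; apply: iter_s_le_iter_t.
Qed.

Lemma st_slide i x : s (iter i.+1 t x) = iter i.+1 s (t x).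
Proof.
(* The number of letters s in front is generalized, since each shift turns one t into a further
   s. *)
suff E k : iter k.+1 s (iter i.+1 t x) = iter (k + i).+1 s (t x).
  exact: (E 0).
elim: i k => [|i IHi] k; first by rewrite addn0.
by rewrite st_shift // IHi addSnnS.
Qed.

Lemma act_s_t (u : word) x :
  s (act s t u (t x)) = iter (size u).+1 s (t x).
Proof.
apply/le_anti/andP; split; last exact/s_mono/iter_s_le_act.
by rewrite -st_slide iterSr; apply/s_mono/act_le_iter_t.
Qed.

End OrderPreservingPair.

(** * Relations *)

Section Relations.
Variables m n : nat.

Lemma word_equiv_refl w : word_equiv m n w w.
Proof. by []. Qed.

Lemma word_equiv_trans v w u :
  word_equiv m n w v -> word_equiv m n v u -> word_equiv m n w u.
Proof.
by move=> E F d L s t sm tm st ps pt x; rewrite (E d L s t) // (F d L s t).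
Qed.

Lemma word_equiv_cat w1 v1 w2 v2 :
  word_equiv m n w1 v1 -> word_equiv m n w2 v2 ->
  word_equiv m n (w1 ++ w2) (v1 ++ v2).
Proof.
move=> E F d L s t sm tm st ps pt x.
by rewrite !act_cat (E d L s t) // (F d L s t).
Qed.

(** In the dual order t is the smaller operator, so exchanging the letters exchanges the exponents
    as well. *)
Lemma word_equiv_flip w v :
  word_equiv n m w v -> word_equiv m n (map flip w) (map flip v).
Proof.
move=> E disp L s t sm tm st ps pt x; rewrite !act_map_flip.
by apply: (E _ L^d t s) => // y z; rewrite leEdual; [apply: tm|apply: sm].
Qed.

Lemma word_equiv_nseq_period a i k : 0 < exponent m n a -> 0 < i ->
  word_equiv m n (nseq (i + k * (exponent m n a - 1)) a) (nseq i a).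
Proof.
case: a => /= e_gt0 i_gt0 d L s t sm tm st ps pt x;
  by rewrite !act_nseq iter_period.
Qed.

End Relations.

Lemma word_equiv_straighten m n a u : 1 < m -> 1 < n ->
  word_equiv m n (a :: rcons u (flip a)) (nseq (size u).+1 a ++ [:: flip a]).
Proof.
(* The exponents are generalized along with the letter because duality swaps them. *)
wlog -> : m n a u / a = Ls => [hw|] m_gt1 n_gt1.
  case: a; first exact: hw.
  have := word_equiv_flip (hw n m Ls (map flip u) erefl n_gt1 m_gt1).
  by rewrite /= map_rcons map_cat map_nseq size_map (mapK flipK).
move=> d L s t sm tm st ps pt x.
rewrite -rcons_cons -cats1 !act_cat act_nseq /=.
exact: act_s_t sm tm st ps pt _ _.
Qed.

Lemma word_equiv_period m n a i k : 1 < m -> 1 < n -> 0 < i ->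
  word_equiv m n (nseq (i + k * gcdn (m - 1) (n - 1)) a ++ [:: flip a])
                 (nseq i a ++ [:: flip a]).
Proof.
wlog -> : m n a / a = Ls => [hw|] m_gt1 n_gt1 i_gt0.
  case: a; first exact: hw.
  have := word_equiv_flip (hw n m Ls erefl n_gt1 m_gt1 i_gt0).
  by rewrite gcdnC !map_cat !map_nseq.
move=> d L s t sm tm st ps pt x.
rewrite !act_cat !act_nseq /=.
elim: k => [|k IHk]; first by rewrite addn0.
by rewrite mulSnr addnA (st_periodl _ _ _ _ _ ps pt) // addn_gt0 i_gt0.
Qed.

(** * Invariants *)

Lemma iter_idempotent (T : Type) (f : T -> T) i :
  (forall x, f (f x) = f x) -> 0 < i -> iter i f =1 f.
Proof.
by move=> ff; case: i => // i _ x; elim: i => // i IHi; rewrite iterS IHi.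
Qed.

(* Rotation of the subsets of Z/k, encoded as sets of naturals because ['Z_k]
   is not Z/k when [k = 1]. *)
Definition shift (k : nat) (A : set nat) : set nat :=
  [set x | A (x.+1 %% k)].

Lemma iter_shift k i A x : iter i.+1 (shift k) A x = A ((x + i.+1) %% k).
Proof.
elim: i x => [|i IHi] x; first by rewrite addn1.
by rewrite -[LHS]/(iter i.+1 (shift k) A (x.+1 %% k)) IHi modnDml addSnnS.
Qed.

Lemma shift_mono k : {homo shift k : A B / (A <= B)%O}.
Proof. by move=> A B; rewrite !subsetEset => AB x; apply: AB. Qed.

Lemma iter_shift_period k m : 0 < m -> k %| m - 1 -> iter m (shift k) =1 shift k.
Proof.
case: m => // m _; rewrite subn1 /= => /dvdnP[q ->] A.
by apply/funext => x; rewrite iter_shift -addSnnS addnC modnMDl.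
Qed.

Lemma iter_shift_inj k i j :
  0 < i -> 0 < j -> iter i (shift k) =1 iter j (shift k) -> i = j %[mod k].
Proof.
(* Both iterates are tested on the singleton of the residue of [i.+1], at the point 0. *)
case: i j => [|i] [|j] // _ _ /(_ [set i.+1 %% k]) /(congr1 (fun A => A 0)).
by rewrite !iter_shift /= !add0n => /esym E; apply/esym; rewrite E.
Qed.

Section Models.
Variables m n : nat.
Hypotheses (m_gt0 : 0 < m) (n_gt0 : 0 < n).

(** With s and t the constant maps false and true on the Booleans, the letter applied last decides
    the value. Starting at false agrees with the default [Ls] on the empty word. *)
Lemma word_equiv_head w v : word_equiv m n w v -> head Ls w = head Ls v.
Proof.
move=> E; apply: (can_inj is_tK).
pose s (_ : bool) := false; pose t (_ : bool) := true.
have actE u : act s t u false = is_t (head Ls u) by case: u => [|[]].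
by rewrite -!actE; apply: E => //; apply: iter_idempotent.
Qed.

(** From the point 1, s moves to 0 and t to 2, and both operators fix these points; hence the letter
    applied first decides the value. *)
Lemma word_equiv_last w v : w <> [::] -> v <> [::] ->
  word_equiv m n w v -> last Ls w = last Ls v.
Proof.
move=> w0 v0 E; apply: (can_inj is_tK).
pose s x := if x == 1 then 0 else x; pose t x := if x == 1 then 2 else x.
have actE u : u <> [::] -> act s t u 1 = is_t (last Ls u) * 2.
  case/lastP: u => // u a _; rewrite last_rcons -cats1 act_cat.
  by case: a; elim: u => [|[] u IHu] //=; rewrite IHu.
suff : is_t (last Ls w) * 2 = is_t (last Ls v) * 2 by do 2!case: is_t.
rewrite -!actE //; apply: E => //.
- by case=> [|[|x]] [|[|y]].
- by case=> [|[|x]] [|[|y]].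
- by case=> [|[|x]].
- by apply: iter_idempotent => // -[|[|x]].
- by apply: iter_idempotent => // -[|[|x]].
Qed.

(** Both letters act as the same rotation, whose order divides m - 1 and n - 1, so only the length
    of the word is seen. *)
Lemma word_equiv_size w v : w <> [::] -> v <> [::] -> word_equiv m n w v ->
  size w = size v %[mod gcdn (m - 1) (n - 1)].
Proof.
move=> w0 v0 E; set k := gcdn _ _.
have actE u : act (shift k) (shift k) u =1 iter (size u) (shift k).
  by move=> A; elim: u => [|[] u /= ->].
apply: iter_shift_inj; [by case: (w) w0|by case: (v) v0|].
move=> A; rewrite -!actE; apply: E => //; try exact: shift_mono.
- exact/iter_shift_period/dvdn_gcdl.
- exact/iter_shift_period/dvdn_gcdr.
Qed.

End Models.

(** With s the identity and t constantly true, the value at false records whether t occurs; duality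
    gives the same for s. *)
Lemma word_equiv_pure m n w v a : 0 < m -> 0 < n ->
  word_equiv m n w v -> pure a w = pure a v.
Proof.
wlog -> : m n w v a / a = Ls => [hw|] m_gt0 n_gt0 E.
  case: a; first exact: (hw m n).
  have pureE u : pure Lt u = pure Ls (map flip u).
    by rewrite /pure all_map; apply: eq_all; case.
  by rewrite !pureE; apply: hw (word_equiv_flip E).
pose t (_ : bool) := true.
have actE u : act id t u false = ~~ pure Ls u by elim: u => [|[]].
apply: negb_inj; rewrite -!actE; apply: E => //; by [case|apply: iter_idempotent].
Qed.

(** Taking t constant with value the top element leaves s free to be a rotation of order m - 1,
    independently of n. *)
Lemma word_equiv_nseq_size m n a i j : 0 < m -> 0 < n -> 0 < i -> 0 < j ->
  word_equiv m n (nseq i a) (nseq j a) -> i = j %[mod exponent m n a - 1].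
Proof.
wlog -> : m n a / a = Ls => [hw|] m_gt0 n_gt0 i_gt0 j_gt0 E.
  case: a E; first exact: hw.
  by move/word_equiv_flip; rewrite !map_nseq => /(hw n m Ls); apply.
apply: iter_shift_inj => // A.
have := E _ (set nat) (shift (m - 1)) (fun=> setT) _ _ _ _ _ A.
rewrite !act_nseq; apply=> //.
- exact: shift_mono.
- by move=> B; rewrite subsetEset.
- exact: iter_shift_period.
- exact: iter_idempotent.
Qed.

(** * Normal forms *)

(** For positive [i], the representative modulo [p] in 1, ..., p rather than 0, ..., p - 1, since
    the exponents in [W] start at 1. *)
Definition residue (i p : nat) : nat := ((i - 1) %% p).+1.

Lemma residue_small i p : 1 <= i <= p -> residue i p = i.
Proof. by case: i => // i /= ip; rewrite /residue subn1 modn_small. Qed.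

Lemma residue_range i p : 0 < p -> 1 <= residue i p <= p.
Proof. by move=> p_gt0; rewrite /residue /= ltn_pmod. Qed.

Lemma residue_le i p : 0 < i -> residue i p <= i.
Proof. by case: i => // i _; rewrite /residue subn1 ltnS leq_mod. Qed.

Lemma residue_def i p : 0 < i -> exists k, i = residue i p + k * p.
Proof.
case: i => // i _; exists (i %/ p); rewrite /residue subn1 addSn addnC.
by rewrite -divn_eq.
Qed.

(** The bounds on [k] keep the truncated subtractions exact, so adding [k.+1] back recovers [i] and
    [j]. *)
Lemma residue_eq i j k p : k < i -> k < j -> i = j %[mod p] ->
  residue (i - k) p = residue (j - k) p.
Proof.
move=> ki kj ij; congr _.+1; apply/eqP; rewrite -(eqn_modDr k.+1).
by apply/eqP; rewrite -!subnDA addn1 !subnK.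
Qed.

(** With a the first letter and b the other one, a mixed word becomes a^i b, or a^i b a when it ends
    in a. The Boolean [returns], read as 0 or 1, counts the closing a, so [returns.+1] is the length
    of what follows a^i. *)
Definition normal_form (m n : nat) (w : word) : word :=
  let a := head Ls w in
  let returns := a == last Ls w in
  if pure a w then nseq (residue (size w) (exponent m n a - 1)) a
  else nseq (residue (size w - returns.+1) (gcdn (m - 1) (n - 1))) a
       ++ flip a :: nseq returns a.

(** The cases match those of [normal_form]. The last one singles out an inner letter different from
    the two equal ends, where the word can be cut. *)
Variant word_shape : word -> Prop :=
  | PureShape a i : word_shape (nseq i.+1 a)
  | StepShape a u : word_shape (a :: rcons u (flip a))
  | ReturnShape a i v : word_shape (nseq i.+1 a ++ flip a :: rcons v a).

Lemma word_shapeP w : w <> [::] -> word_shape w.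
Proof.
case: w => // a u _; have [/all_pred1P ->|] := boolP (pure a (a :: u)).
  exact: PureShape.
rewrite /pure /= eqxx /=; case/lastP: u => // u b.
have [->|/flip_neq ->] := eqVneq a b; last by move=> _; apply: StepShape.
rewrite all_rcons /= eqxx => /impure_split[i [v ->]].
by rewrite rcons_cat; apply: (ReturnShape b i v).
Qed.

Lemma flip_eqF a : (a == flip a = false) * (flip a == a = false).
Proof. by case: a. Qed.

Section NormalForm.
Variables m n : nat.
Let d := gcdn (m - 1) (n - 1).

Lemma normal_form_pure a i :
  normal_form m n (nseq i.+1 a) = nseq (residue i.+1 (exponent m n a - 1)) a.
Proof. by rewrite /normal_form /pure all_pred1_nseq size_nseq. Qed.

Lemma normal_form_step a u :
  normal_form m n (a :: rcons u (flip a)) =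
  nseq (residue (size u).+1 d) a ++ [:: flip a].
Proof.
rewrite /normal_form /pure /= last_rcons flip_eqF all_rcons /= !flip_eqF andbF.
by rewrite size_rcons subn1.
Qed.

Lemma normal_form_return a i v :
  normal_form m n (nseq i.+1 a ++ flip a :: rcons v a) =
  nseq (residue (i + size v).+1 d) a ++ [:: flip a; a].
Proof.
rewrite /normal_form /= last_cat /= last_rcons eqxx.
rewrite /pure all_cat /= !flip_eqF !andbF size_cat size_nseq /= size_rcons.
by rewrite !addnS subSS subn1.
Qed.

Lemma word_equiv_normal_form w : 1 < m -> 1 < n -> w <> [::] ->
  word_equiv m n w (normal_form m n w).
Proof.
move=> m_gt1 n_gt1 /word_shapeP[a i|a u|a i v].
- rewrite normal_form_pure.
  have [k {1}->] := @residue_def i.+1 (exponent m n a - 1) isT.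
  by apply: word_equiv_nseq_period => //; case: a; apply: ltnW.
- rewrite normal_form_step.
  apply: word_equiv_trans (word_equiv_straighten _ _ _ _) _ => //.
  have [k {1}->] := @residue_def (size u).+1 d isT.
  exact: word_equiv_period.
- rewrite normal_form_return.
  (* With b the other letter, the suffix b v a straightens to b^(|v|+1) a. What precedes the final a
     is then a u b, which straightens in turn. *)
  pose u := nseq i a ++ nseq (size v) (flip a).
  apply: (@word_equiv_trans _ _ ((a :: rcons u (flip a)) ++ [:: a])).
    have := word_equiv_straighten (flip a) v m_gt1 n_gt1; rewrite flipK.
    move/(word_equiv_cat (@word_equiv_refl m n (nseq i.+1 a))).
    rewrite /u rcons_cat -[rcons (nseq _ _) _]cats1 -(nseqD _ 1) addn1 /=.
    by rewrite -catA.
  have -> : nseq (residue (i + size v).+1 d) a ++ [:: flip a; a] =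
    (nseq (residue (size u).+1 d) a ++ [:: flip a]) ++ [:: a].
    by rewrite -catA size_cat !size_nseq.
  apply: word_equiv_cat => //.
  apply: word_equiv_trans (word_equiv_straighten _ _ _ _) _ => //.
  have [k {1}->] := @residue_def (size u).+1 d isT.
  exact: word_equiv_period.
Qed.

End NormalForm.

(** The six families of [W] become two once the first letter and the presence of a closing letter
    are parameters. *)
Variant normal_word (m n : nat) : word -> Prop :=
  | NormalPure a i of 1 <= i <= exponent m n a - 1 :
      normal_word m n (nseq i a)
  | NormalMixed a i (returns : bool) of 1 <= i <= gcdn (m - 1) (n - 1) :
      normal_word m n (nseq i a ++ flip a :: nseq returns a).

Lemma WP m n w : W m n w <-> normal_word m n w.
Proof.
split=> [[[[i i_range <-]|[i i_range <-]]|[i i_range]]|].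
- exact: (NormalPure (a := Ls)).
- exact: (NormalPure (a := Lt)).
- case=> ->.
  + exact: (NormalMixed Ls false).
  + exact: (NormalMixed Ls true).
  + exact: (NormalMixed Lt false).
  + exact: (NormalMixed Lt true).
- case=> [[] i i_range|[] i [] i_range].
  + by left; left; exists i.
  + by left; right; exists i.
  + by right; exists i => //; constructor 2.
  + by right; exists i => //; constructor 1.
  + by right; exists i => //; constructor 4.
  + by right; exists i => //; constructor 3.
Qed.

(** * Existence, uniqueness and minimality of the representatives *)

Lemma normal_word_nonempty m n w : normal_word m n w -> w <> [::].
Proof. by case=> [a [|i]|a [|i]]. Qed.

Lemma normal_form_normal m n w : 1 < m -> 1 < n ->
  normal_word m n (normal_form m n w).
Proof.
move=> m_gt1 n_gt1; rewrite /normal_form; case: ifP => _.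
  apply: NormalPure; apply: residue_range.
  by case: head; rewrite subn_gt0.
by apply: NormalMixed; apply: residue_range; rewrite gcdn_gt0 subn_gt0 m_gt1.
Qed.

Lemma normal_form_id m n w : normal_word m n w -> normal_form m n w = w.
Proof.
case=> [a [|i] // i_range|a [|i] // [] i_range].
- by rewrite normal_form_pure residue_small.
- by rewrite (normal_form_return m n a i [::]) addn0 residue_small.
- have := normal_form_step m n a (nseq i a).
  by rewrite -cats1 size_nseq residue_small.
Qed.

Lemma normal_form_size m n w : w <> [::] -> size (normal_form m n w) <= size w.
Proof.
case/word_shapeP=> [a i|a u|a i v].
- by rewrite normal_form_pure !size_nseq residue_le.
- rewrite normal_form_step size_cat size_nseq /= size_rcons addn1 ltnS.
  exact: residue_le.
- rewrite normal_form_return !size_cat !size_nseq [size (_ :: rcons _ _)]/=.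
  rewrite size_rcons addn2 !addnS 2!ltnS; exact: residue_le.
Qed.

(** A mixed word has at least two letters, and at least three if its ends agree; so the subtraction
    in [normal_form] leaves a positive number. *)
Lemma impure_size w : ~~ pure (head Ls w) w ->
  (head Ls w == last Ls w).+1 < size w.
Proof. by case: w => [|[] [|[] [|c w]]] //= _; case: (_ == _). Qed.

(** Every datum from which [normal_form] is computed is one of the invariants above. *)
Lemma word_equiv_normal_form_eq m n w v : 1 < m -> 1 < n ->
  w <> [::] -> v <> [::] -> word_equiv m n w v ->
  normal_form m n w = normal_form m n v.
Proof.
move=> /ltnW m_gt0 /ltnW n_gt0 w0 v0 E.
have hE := word_equiv_head m_gt0 n_gt0 E.
have lE := word_equiv_last m_gt0 n_gt0 w0 v0 E.
have pE a := word_equiv_pure a m_gt0 n_gt0 E.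
have sE := word_equiv_size m_gt0 n_gt0 w0 v0 E.
rewrite /normal_form -hE -lE -pE; case: ifPn => [p|ip].
  have wE := all_pred1P _ _ p; have vE := p; rewrite pE in vE.
  have {}vE := all_pred1P _ _ vE.
  (* Subtracting 0 puts the lengths in the form of [residue_eq] with k = 0. *)
  congr nseq; rewrite -[size w]subn0 -[size v]subn0; apply: residue_eq.
  - by case: (w) w0.
  - by case: (v) v0.
  - apply: word_equiv_nseq_size => //; [by case: (w) w0|by case: (v) v0|].
    by rewrite -wE -vE.
rewrite (residue_eq _ _ sE) //; first exact: impure_size.
by rewrite hE lE impure_size // -hE -pE.
Qed.

Theorem theorem4 (m n : nat) (hm : 2 <= m) (hmn : m <= n) :
  [/\ W m n `<=` nonempty_words,
      (forall C : set word, Ch m n C -> exists! w : word, (W m n `&` C) w) &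
      (forall w : word, W m n w -> reduced m n w)].
Proof.
have n_gt1 : 1 < n := leq_trans hm hmn.
split=> [w /WP/normal_word_nonempty //| _ [w w0 <-]|w /WP w_normal v [v0 wv]].
- exists (normal_form m n w); split=> [|v [/WP v_normal [v0 wv]]].
    split; first exact/WP/normal_form_normal.
    split; last exact: word_equiv_normal_form.
    exact/normal_word_nonempty/normal_form_normal.
  by rewrite (word_equiv_normal_form_eq hm n_gt1 w0 v0 wv) normal_form_id.
- have w0 := normal_word_nonempty w_normal.
  (* The word [w] is its own normal form, hence also that of [v], and so is no longer than [v]. *)
  rewrite -leqNgt -(normal_form_id w_normal).
  rewrite (word_equiv_normal_form_eq hm n_gt1 w0 v0 wv).
  exact: normal_form_size.
Qed.
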